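(* Let $X$ and $Y$ be Banach spaces, $S\in\mathcal{L}(X,Y)$, $F\subset X$ convex and $n\in\mathbb{N}$. Then \[ c_{n-1}(S,F)\le\Big(\prod_{k=0}^{n-1}c_k(S,F)\Big)^{1/n}\le n^{3/2}\Big(\prod_{k=0}^{n-1}h_k(S,F)\Big)^{1/n}. \] Moreover: (a) if $F$ is symmetric, the exponent $3/2$ can be replaced by $1$; (b) if $Y$ is a Hilbert space, the exponent $3/2$ can be replaced by $1$; (c) if $F$ is symmetric and $Y$ is a Hilbert space, $3/2$ can be replaced by $1/2$; (d) if $X$ is a Hilbert space and $F=B_X$, then $c_{2n-2}(S,F)\le\big(\prod_{k=0}^{n-1}c_{2k}(S,F)\big)^{1/n}\le n^{1/2}\big(\prod_{k=0}^{n-1}h_k(S,F)\big)^{1/n}$.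
   Context: Gelfand numbers: $c_n(S,F)=\inf_{L_1,\dots,L_n\in X'}\sup\{\tfrac12\|S(f)-S(g)\|: f,g\in F,\ L_k(f)=L_k(g)\ \forall k\le n\}$. Hilbert numbers: $h_n(S,F)=\sup\{c_n(BSA,B_{\ell_2}): B\in\mathcal{L}(Y,\ell_2),\ \|B\|\le1,\ A\in\mathcal{L}(\ell_2,X),\ x\in F,\ A(B_{\ell_2})+x\subset F\}$. $B_X$ is the closed unit ball of $X$, $X'$ its dual. *)

(* Defs.v *)
From HB Require Import structures.
From mathcomp Require Import all_boot all_order all_algebra.
From mathcomp Require Import all_classical all_reals all_analysis.
Set Implicit Arguments. Unset Strict Implicit. Unset Printing Implicit Defensive.
Import Order.TTheory GRing.Theory Num.Theory.
Import numFieldNormedType.Exports.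
Local Open Scope classical_set_scope.
Local Open Scope ring_scope.

Section Defs.
Variable R : realType.

Definition lin_functional (X : lmodType R) (L : X -> R) :=
  forall (a : R) (x y : X), L (a *: x + y) = a * L x + L y.

Definition lin_operator (X Y : lmodType R) (T : X -> Y) :=
  forall (a : R) (x y : X), T (a *: x + y) = a *: T x + T y.

Definition bounded_linear (X Y : normedModType R) (T : X -> Y) :=
  lin_operator T /\ continuous T.

Definition in_dual (X : normedModType R) (L : X -> R) :=
  lin_functional L /\ continuous L.

Definition unit_ball (X : normedModType R) : set X := [set x | `|x| <= 1].

Definition symmetric_set (X : lmodType R) (F : set X) :=
  forall x, F x -> F (- x).

Definition is_hilbert (X : normedModType R) :=
  exists ip : X -> X -> R,
    (forall x y, ip x y = ip y x) /\
    (forall (a : R) x y z, ip (a *: x + y) z = a * ip x z + ip y z) /\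
    (forall x, ip x x = `|x| ^+ 2).

Definition gelfand_gen (V : Type) (W : zmodType) (dual : (V -> R) -> Prop)
    (nW : W -> R) (T : V -> W) (F : set V) (n : nat) : \bar R :=
  ereal_inf [set r | exists L : 'I_n -> V -> R, (forall k, dual (L k)) /\
    r = ereal_sup [set s | exists f g, F f /\ F g /\
          (forall k, L k f = L k g) /\ s = (2^-1 * nW (T f - T g))%:E]].

Definition gelfand (X Y : normedModType R) (S : X -> Y) (F : set X) (n : nat) :=
  gelfand_gen (@in_dual X) (fun y : Y => `|y|) S F n.

Definition ell2 : set (nat -> R) :=
  [set u : nat -> R | cvgn (series (fun k => u k ^+ 2) : R^nat)].

Definition l2norm (u : nat -> R) : R :=
  Num.sqrt (limn (series (fun k => u k ^+ 2) : R^nat)).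

Definition l2add (u v : nat -> R) : nat -> R := fun k => u k + v k.
Definition l2scale (a : R) (u : nat -> R) : nat -> R := fun k => a * u k.

Definition l2ball : set (nat -> R) := [set u | ell2 u /\ l2norm u <= 1].

Definition in_l2dual (L : (nat -> R) -> R) :=
  (forall a u v, ell2 u -> ell2 v -> L (l2add (l2scale a u) v) = a * L u + L v) /\
  (exists C : R, forall u, ell2 u -> `|L u| <= C * l2norm u).

Definition gelfand_l2 (T : (nat -> R) -> (nat -> R)) (n : nat) : \bar R :=
  gelfand_gen in_l2dual l2norm T l2ball n.

Definition hilbert_num (X Y : normedModType R) (S : X -> Y) (F : set X) (n : nat)
    : \bar R :=
  ereal_sup [set r | exists (B : Y -> nat -> R) (A : (nat -> R) -> X) (x : X),
    (forall y, ell2 (B y)) /\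
    (forall (a : R) y y', B (a *: y + y') = l2add (l2scale a (B y)) (B y')) /\
    (forall y, l2norm (B y) <= `|y|) /\
    (forall a u v, ell2 u -> ell2 v -> A (l2add (l2scale a u) v) = a *: A u + A v) /\
    (exists C : R, forall u, ell2 u -> `|A u| <= C * l2norm u) /\
    (forall u, l2ball u -> F (A u + x)) /\
    r = gelfand_l2 (B \o S \o A) n].

Definition geo_mean (n : nat) (c : nat -> \bar R) : \bar R :=
  poweR (\big[*%E/1%E]_(k < n) c k)%E (n%:R^-1).

End Defs.

(* Main.v *)
(* Greedy selection: f_k, g_k in F agree on the functionals chosen so far and have
   h_k = (f_k - g_k)/2 with |S h_k| close to c_k, and the next functional phi_k on
   Y norms S h_k.  The matrix phi_j (S h_k) is then triangular with diagonal close
   to the c_k.  Up to scalings it factors as B S A through ell^2, the scalings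
   being 1/n (F convex), 1/sqrt n (F symmetric) or 1 (F a Hilbert ball, with the
   h_k orthogonal) for A, and 1/sqrt n or 1 (Y Hilbert) for B.  Finally |det M| is
   at most the product of the Gelfand numbers of M: choose an orthonormal basis
   whose k-th vector lies in the kernel of k almost optimal functionals for the
   k-th Gelfand number and apply Hadamard's inequality. *)
Require Import Defs.
From HB Require Import structures.
From mathcomp Require Import all_boot all_order all_algebra.
From mathcomp Require Import all_classical all_reals all_analysis.
From mathcomp Require Import ring lra zify.
Set Implicit Arguments. Unset Strict Implicit. Unset Printing Implicit Defensive.
Import Order.TTheory GRing.Theory Num.Theory.
Import numFieldNormedType.Exports.
Local Open Scope classical_set_scope.
Local Open Scope ring_scope.

(** * Norming functionals *)

Section HahnBanach.
Variables (R : realType) (V : normedModType R).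
Implicit Types (p q : V -> R) (x y : V).

(** Homogeneity is only an inequality for [t > 0]; applied to [t^-1] it yields the reverse one. *)
Definition sublinear p :=
  (forall x y, p (x + y) <= p x + p y) /\
  (forall (t : R) x, 0 < t -> p (t *: x) <= t * p x).

Lemma sublinear0 p : sublinear p -> p 0 = 0.
Proof.
move=> [pD pZ]; apply/eqP; rewrite eq_le; apply/andP; split.
  have := pZ 2^-1 0; rewrite scaler0 => /(_ ltac:(lra)); lra.
by have := pD 0 0; rewrite addr0; lra.
Qed.

Lemma sublinear_opp p x : sublinear p -> - p (- x) <= p x.
Proof.
move=> sp; have := sp.1 x (- x); rewrite subrr (sublinear0 sp); lra.
Qed.

(** For sublinear [p] this is the largest sublinear functional below [p] whose value at [- y] is at
    most [- p y]. *)
Definition lower p y x : R :=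
  inf [set r | exists t, 0 <= t /\ r = p (x + t *: y) - t * p y].

(** The infimum is over a set bounded below by [- p (- x)], since [t * p y <= p (t *: y) <= p (x + t
    *: y) + p (- x)]. *)
Lemma lower_le p y x t : sublinear p -> 0 <= t ->
  lower p y x <= p (x + t *: y) - t * p y.
Proof.
move=> sp t0; apply: ge_inf; last by exists t.
exists (- p (- x)) => _ [s [s0 ->]].
have [->|sn0] := eqVneq s 0.
  by rewrite scale0r addr0 mul0r subr0 sublinear_opp.
have sgt0 : 0 < s by rewrite lt_def sn0.
have : s * p y <= p (s *: y).
  have := sp.2 s^-1 (s *: y).
  rewrite invr_gt0 => /(_ sgt0); rewrite scalerA mulVf// scale1r.
  by rewrite mulrC ler_pdivlMr // mulrC.
have := sp.1 (x + s *: y) (- x); rewrite addrAC subrr add0r; lra.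
Qed.

Lemma le_lower p y x m : (forall t, 0 <= t -> m <= p (x + t *: y) - t * p y) ->
  m <= lower p y x.
Proof.
move=> h; apply: lb_le_inf; last by move=> _ [t [t0 ->]]; exact: h.
by exists (p (x + 0 *: y) - 0 * p y), 0.
Qed.

Lemma lower_self p y x : sublinear p -> lower p y x <= p x.
Proof.
by move=> sp; have := lower_le y x sp (lexx 0);
  rewrite scale0r addr0 mul0r subr0.
Qed.

Lemma lower_sublinear p y : sublinear p -> sublinear (lower p y).
Proof.
move=> sp; split.
  move=> x x'; rewrite -lerBlDr; apply: le_lower => t t0.
  rewrite lerBlDr -lerBlDl; apply: le_lower => t' t'0.
  have := lower_le y (x + x') sp (addr_ge0 t0 t'0).
  have := sp.1 (x + t *: y) (x' + t' *: y).
  rewrite scalerDl addrACA; lra.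
move=> s x s0; rewrite mulrC -ler_pdivrMr//; apply: le_lower => t t0.
rewrite ler_pdivrMr//.
have := lower_le y (s *: x) sp (mulr_ge0 (ltW s0) t0).
have := sp.2 s (x + t *: y) s0; rewrite scalerDr scalerA; lra.
Qed.

(* A minimal sublinear functional equals each of its [lower p y], which makes it
   additive. *)
Lemma minimal_sublinear_linear p : sublinear p ->
  (forall q, sublinear q -> (forall x, q x <= p x) -> forall x, p x <= q x) ->
  lin_functional p.
Proof.
move=> sp pmin.
have pD x y : p (x + y) = p x + p y.
  apply/eqP; rewrite eq_le sp.1/=.
  have := pmin _ (lower_sublinear y sp) (fun z => lower_self y z sp) x.
  have := lower_le y x sp ler01; rewrite scale1r; lra.
have pN x : p (- x) = - p x.
  by have := pD x (- x); rewrite subrr sublinear0//; lra.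
have pZ t x : 0 < t -> p (t *: x) = t * p x.
  move=> t0; apply/eqP; rewrite eq_le sp.2//=.
  by have := sp.2 t (- x) t0; rewrite scalerN !pN; lra.
move=> a x y; rewrite pD; congr (_ + _).
have [a0|a0|->] := ltgtP a 0; last by rewrite scale0r mul0r sublinear0.
  by have := pZ (- a) x; rewrite scaleNr pN oppr_gt0 => /(_ a0); lra.
exact: pZ.
Qed.

(** The pointwise infimum works: [- p0 (- x)] bounds the values from below, and of two members
    chosen for [x] and for [y] the smaller serves both. *)
Lemma chain_inf_sublinear p0 (A : set (V -> R)) :
  (forall p, A p -> sublinear p /\ forall x, p x <= p0 x) ->
  (forall p q, A p -> A q -> (forall x, p x <= q x) \/ (forall x, q x <= p x)) ->
  A !=set0 ->
  exists2 q, sublinear q & forall p, A p -> forall x, q x <= p x.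
Proof.
move=> Ap Atot [p1 Ap1].
pose E x : set R := [set r | exists2 p, A p & r = p x].
pose q x := inf (E x).
have lbE x : has_lbound (E x).
  exists (- p0 (- x)) => _ [p /Ap [sp pp0] ->].
  by apply: le_trans (sublinear_opp _ sp); rewrite lerN2.
have q_le p x : A p -> q x <= p x by move=> Ap'; apply: ge_inf => //; exists p.
have le_q x m : (forall p, A p -> m <= p x) -> m <= q x.
  move=> h; apply: lb_le_inf; first by exists (p1 x), p1.
  by move=> _ [p /h ? ->].
exists q; last by move=> p Ap' x; exact: q_le.
split.
  move=> x y; rewrite -lerBlDr; apply: (le_q) => p Apx.
  rewrite lerBlDr -lerBlDl; apply: (le_q) => p' Apy.
  have [ple|ple] := Atot _ _ Apx Apy.
    have := (Ap _ Apx).1.1 x y; have := q_le _ (x + y) Apx; have := ple y; lra.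
  have := (Ap _ Apy).1.1 x y; have := q_le _ (x + y) Apy; have := ple x; lra.
move=> t x t0; rewrite mulrC -ler_pdivrMr//; apply: (le_q) => p Apx.
rewrite ler_pdivrMr//.
have := (Ap _ Apx).1.2 _ x t0; have := q_le _ (t *: x) Apx; lra.
Qed.

Lemma sublinear_dominates_linear p0 : sublinear p0 ->
  exists2 p, lin_functional p & forall x, p x <= p0 x.
Proof.
move=> sp0.
pose T := {p : V -> R | sublinear p /\ forall x, p x <= p0 x}.
(* The order is reversed, so a maximal element from Zorn's lemma is a pointwise minimal sublinear
   functional. *)
pose le (s t : T) : bool := `[< forall x, sval t x <= sval s x >].
have t0 : T by exists p0; split.
have [||A Atot|[p [sp pp0]] pmax] := @ZL_preorder T t0 le.
- by move=> t; apply/asboolP.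
- move=> r s t /asboolP rs /asboolP st; apply/asboolP => x.
  exact: le_trans (st x) (rs x).
- have [->|/set0P[t1 At1]] := eqVneq A set0; first by exists t0.
  have [|||q sq qA] := @chain_inf_sublinear p0 [set sval t | t in A].
  + by move=> _ [t At <-]; exact: svalP t.
  + move=> _ _ [s As <-] [t At <-].
    by have [/asboolP|/asboolP] := Atot _ _ As At; [right|left].
  + by exists (sval t1), t1.
  have qp0 x : q x <= p0 x.
    apply: le_trans (qA (sval t1) _ x) _; first by exists t1.
    exact: (svalP t1).2.
  exists (exist _ q (conj sq qp0) : T) => s As; apply/asboolP => x /=.
  by apply: qA; exists s.
exists p => //; apply: minimal_sublinear_linear => // q sq qp x.
have qp0 z : q z <= p0 z by exact: le_trans (qp z) (pp0 z).
have pq : le (exist _ p (conj sp pp0)) (exist _ q (conj sq qp0)).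
  by apply/asboolP.
exact: (asboolW (pmax _ pq)).
Qed.

Lemma norm_sublinear : sublinear (fun x : V => `|x|).
Proof.
split; first exact: ler_normD.
by move=> t x t0; rewrite normrZ gtr0_norm.
Qed.

Lemma bounded_in_dual (L : V -> R) (C : R) :
  lin_functional L -> (forall x, `|L x| <= C * `|x|) -> in_dual L.
Proof.
move=> linL bL; split => // x.
have LB y z : L (y - z) = L y - L z.
  by rewrite addrC -scaleN1r linL; lra.
(* [C] may be zero or negative, while the division below needs a positive bound. *)
have C1 : 0 < `|C| + 1 by rewrite ltr_wpDl.
apply/cvgrPdist_lt => e e0.
near=> y; rewrite -LB; apply: le_lt_trans (bL _) _.
apply: (@le_lt_trans _ _ ((`|C| + 1) * `|x - y|)).
  by apply: ler_wpM2r => //; rewrite (le_trans (ler_norm _))// lerDl.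
rewrite mulrC -ltr_pdivlMr//.
near: y; apply: cvgr_dist_lt; last exact: divr_gt0.
exact: cvg_id.
Unshelve. all: by end_near. Qed.

(** A linear functional below [lower] of the norm at [w] is below the norm and satisfies
    [L (- w) <= - |w|], which forces equality at [w]. *)
Lemma norming_functional (w : V) :
  exists L : V -> R, [/\ in_dual L, L w = `|w| & forall x, `|L x| <= `|x|].
Proof.
have [L linL LE] :=
  sublinear_dominates_linear (lower_sublinear w norm_sublinear).
have Lle x : L x <= `|x|.
  exact: le_trans (LE x) (lower_self _ _ norm_sublinear).
have LN x : L (- x) = - L x.
  have L0 : L 0 = 0 by have := linL 1 0 0; rewrite scaler0 addr0; lra.
  by rewrite -[- x]addr0 -scaleN1r linL L0; lra.
have Labs x : `|L x| <= `|x|.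
  by rewrite ler_norml Lle andbT lerNl -LN -normrN; exact: Lle.
exists L; split=> //.
  by apply: (@bounded_in_dual _ 1) => // x; rewrite mul1r.
apply/eqP; rewrite eq_le Lle/= -lerN2 -LN; apply: le_trans (LE _) _.
have := lower_le w (- w) norm_sublinear ler01.
by rewrite scale1r addNr normr0 mul1r sub0r.
Qed.

End HahnBanach.

(** * Determinants and orthonormal frames *)

(** Finite successive choice, used for orthonormal frames and for the greedy pairs: [P] restricts a
    term by itself, [Q] relates it to each earlier one. *)
Lemma compatible_sequence (Z : Type) (z0 : Z) (P : nat -> Z -> Prop)
    (Q : Z -> Z -> Prop) (n : nat) :
  (forall k (s : nat -> Z), (k < n)%N ->
     (forall j, (j < k)%N -> P j (s j)) ->
     exists z, P k z /\ forall j, (j < k)%N -> Q (s j) z) ->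
  exists s : nat -> Z, forall k, (k < n)%N ->
    P k (s k) /\ forall j, (j < k)%N -> Q (s j) (s k).
Proof.
elim: n => [|n IH] step; first by exists (fun=> z0).
have [k s kn|s Ps] := IH; first by apply: step; rewrite ltnS ltnW.
have [j jn|z [Pz Qz]] := step n s (ltnSn n); first exact: (Ps j jn).1.
exists (fun k => if k == n then z else s k) => k.
rewrite ltnS leq_eqVlt => /predU1P[->|kn].
  by rewrite eqxx; split=> // j jn; rewrite ltn_eqF//; exact: Qz.
rewrite ltn_eqF//; split; first exact: (Ps k kn).1.
by move=> j jk; rewrite ltn_eqF ?(ltn_trans jk)//; exact: (Ps k kn).2.
Qed.

Section Determinants.
Variable R : realType.

Definition dotr n (u v : 'rV[R]_n) : R := (u *m v^T) 0 0.

Lemma dotrE n (u v : 'rV[R]_n) : dotr u v = \sum_i u 0 i * v 0 i.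
Proof. by rewrite /dotr mxE; apply: eq_bigr => i _; rewrite mxE. Qed.

Lemma dotrC n (u v : 'rV[R]_n) : dotr u v = dotr v u.
Proof. by rewrite !dotrE; apply: eq_bigr => i _; rewrite mulrC. Qed.

Lemma dotrDZl n c (u v w : 'rV[R]_n) :
  dotr (u + c *: v) w = dotr u w + c * dotr v w.
Proof. by rewrite /dotr mulmxDl -scalemxAl !mxE. Qed.

Lemma dotrZ n a b (u v : 'rV[R]_n) : dotr (a *: u) (b *: v) = a * b * dotr u v.
Proof. by rewrite /dotr linearZ/= -scalemxAl -scalemxAr scalerA mxE. Qed.

Lemma dotr_ge0 n (u : 'rV[R]_n) : 0 <= dotr u u.
Proof. by rewrite dotrE; apply: sumr_ge0 => i _; rewrite -expr2 sqr_ge0. Qed.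

Lemma dotr_eq0 n (u : 'rV[R]_n) : dotr u u = 0 -> u = 0.
Proof.
rewrite dotrE => /eqP; rewrite psumr_eq0 => [/allP u0|i _]; last first.
  by rewrite -expr2 sqr_ge0.
apply/rowP => i; have := u0 i; rewrite mem_index_enum => /(_ isT).
by rewrite mulf_eq0 orbb mxE => /eqP.
Qed.

(** The squared length of [u - dotr u w *: w] equals [dotr u u - dotr u w ^+ 2] and is
    nonnegative. *)
Lemma dotr_unit_le n (u w : 'rV[R]_n) : dotr w w = 1 ->
  `|dotr u w| <= Num.sqrt (dotr u u).
Proof.
move=> w1; rewrite -sqrtr_sqr ler_wsqrtr//.
have := dotr_ge0 (u - dotr u w *: w).
have -> : dotr (u - dotr u w *: w) (u - dotr u w *: w) =
    dotr u u - 2 * dotr u w * dotr u w + dotr u w ^+ 2 * dotr w w.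
  by rewrite -scaleNr dotrDZl !(dotrC _ (u + _)) !dotrDZl (dotrC w u); ring.
rewrite w1; lra.
Qed.

Lemma unit_row_in_ker n m (A : 'M[R]_(n, m)) : (m < n)%N ->
  exists v : 'rV_n, v *m A = 0 /\ dotr v v = 1.
Proof.
move=> mn; have : kermx A != 0.
  by rewrite kermx_eq0 /row_free; have := rank_leq_col A; lia.
move=> /rowV0Pn[v /sub_kermxP vA v0].
have vgt0 : 0 < dotr v v.
  rewrite lt_def dotr_ge0 andbT; apply: contra_neq v0; exact: dotr_eq0.
exists ((Num.sqrt (dotr v v))^-1 *: v); split.
  by rewrite -scalemxAl vA scaler0.
rewrite dotrZ -invfM -expr2 sqr_sqrtr ?dotr_ge0// mulVf// gt_eqF//.
Qed.

(* Choose the last row first: row [k] has to satisfy [k] constraints from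
   [N k] and [n - 1 - k] orthogonality constraints, hence fewer than [n]. *)
Lemma adapted_orthonormal_frame n (N : forall k : nat, 'M[R]_(n, k)) :
  exists V : 'M[R]_n, V *m V^T = 1%:M /\ forall k : 'I_n, row k V *m N k = 0.
Proof.
have [i s ltin _|s sP] := @compatible_sequence 'rV[R]_n 0
    (fun i v => v *m N (n.-1 - i)%N = 0 /\ dotr v v = 1)
    (fun u v => dotr u v = 0) n.
  pose A : 'M[R]_(n, i) := \matrix_(a, j) s j 0 a.
  have [|v [vA v1]] := @unit_row_in_ker _ _ (row_mx (N (n.-1 - i)%N) A).
    by lia.
  move: vA; rewrite mul_mx_row -(@row_mx0 _ _ (n.-1 - i)%N i) => /eq_row_mx[vN vA].
  exists v; split=> // j ltji.
  have /rowP/(_ (Ordinal ltji)) := vA.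
  rewrite !mxE dotrC dotrE => vs0; rewrite -[RHS]vs0.
  by apply: eq_bigr => a _; rewrite !mxE.
exists (\matrix_(k < n) s (n.-1 - k)%N); split; last first.
  move=> k; rewrite rowK.
  have [|[+ _] _] := sP (n.-1 - k)%N; first by have := ltn_ord k; lia.
  by rewrite (_ : (n.-1 - (n.-1 - k))%N = k)//; have := ltn_ord k; lia.
have orth (i j : 'I_n) : (i < j)%N ->
    dotr (s (n.-1 - i)%N) (s (n.-1 - j)%N) = 0.
  move=> ij; rewrite dotrC.
  by apply: (sP (n.-1 - i)%N _).2; have := ltn_ord j; lia.
apply/matrixP => i j; rewrite !mxE.
transitivity (dotr (s (n.-1 - i)%N) (s (n.-1 - j)%N)).
  by rewrite dotrE; apply: eq_bigr => a _; rewrite !mxE.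
have [ij|ij|/val_inj ->] := ltngtP i j.
- by rewrite orth// -val_eqE/= ltn_eqF.
- by rewrite dotrC orth// -val_eqE/= gtn_eqF.
- by rewrite eqxx; apply: (sP (n.-1 - j)%N _).1.2; have := ltn_ord j; lia.
Qed.

Lemma normr_det_orthogonal n (V : 'M[R]_n) : V *m V^T = 1%:M -> `|\det V| = 1.
Proof.
move=> /(congr1 determinant); rewrite det_mulmx det_tr det1 -expr2 => /eqP.
by rewrite -real_normK ?num_real// sqrp_eq1// => /eqP.
Qed.

(* In an orthonormal frame whose row [k] is orthogonal to the first [k] rows of
   [A], the matrix [A] becomes triangular. *)
Lemma hadamard_inequality n (A : 'M[R]_n) :
  `|\det A| <= \prod_k Num.sqrt (dotr (row k A) (row k A)).
Proof.
(* [inord] below needs a nonempty index type, so size [0] is treated apart. *)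
case: n A => [|n] A.
  by rewrite [A]flatmx0 big_ord0 det_mx00 normr1.
have [W [WW WN]] := @adapted_orthonormal_frame n.+1
  (fun k => \matrix_(a < n.+1, j < k) A (inord j) a).
have W1 k : dotr (row k W) (row k W) = 1.
  have /matrixP/(_ k k) := WW; rewrite !mxE eqxx mulr1n => W1; rewrite -[RHS]W1.
  by rewrite dotrE; apply: eq_bigr => a _; rewrite !mxE.
have AWE i j : (A *m W^T) i j = dotr (row i A) (row j W).
  by rewrite dotrE mxE; apply: eq_bigr => a _; rewrite !mxE.
have trigAW : is_trig_mx (A *m W^T).
  apply/is_trig_mxP => i j ij; rewrite AWE dotrC dotrE.
  have /rowP/(_ (Ordinal ij)) := WN j; rewrite !mxE => WA0; rewrite -[RHS]WA0.
  by apply: eq_bigr => a _; rewrite !mxE/= inord_val.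
have -> : `|\det A| = `|\det (A *m W^T)|.
  by rewrite det_mulmx det_tr normrM (normr_det_orthogonal WW) mulr1.
rewrite det_trig// normr_prod; apply: ler_prod => k _.
by rewrite normr_ge0/= AWE; exact: dotr_unit_le (W1 k).
Qed.

(** For an orthonormal frame [V] adapted to [N], the matrix [V *m M^T] has the same determinant up
    to sign, and its row [k] is the image of a unit vector killed by [N k]. Hadamard's inequality
    concludes. *)
Lemma det_le_prod_constrained_norms n (M : 'M[R]_n)
    (N : forall k : nat, 'M[R]_(n, k)) (s : nat -> R) :
  (forall k (v : 'rV_n), (k < n)%N -> v *m N k = 0 -> dotr v v = 1 ->
     Num.sqrt (dotr (v *m M^T) (v *m M^T)) <= s k) ->
  `|\det M| <= \prod_(k < n) s k.
Proof.
move=> Ms; have [V [VV VN]] := adapted_orthonormal_frame N.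
have -> : `|\det M| = `|\det (V *m M^T)|.
  by rewrite det_mulmx det_tr normrM (normr_det_orthogonal VV) mul1r.
apply: le_trans (hadamard_inequality _) _; apply: ler_prod => k _.
rewrite sqrtr_ge0 row_mul Ms//.
have /matrixP/(_ k k) := VV; rewrite !mxE eqxx mulr1n => W1; rewrite -[RHS]W1.
by rewrite dotrE; apply: eq_bigr => a _; rewrite !mxE.
Qed.

(** Almost optimal functionals only give bounds strictly above the infima [r k]; the limit is taken
    one factor at a time, with [P] collecting the factors already fixed. *)
Lemma le_prod_of_gt n (D P : R) (r : nat -> R) : 0 <= P ->
  (forall k, 0 <= r k) ->
  (forall s : nat -> R, (forall k, r k < s k) -> D <= P * \prod_(k < n) s k) ->
  D <= P * \prod_(k < n) r k.
Proof.
elim: n P r => [|n IH] P r P0 r0 h.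
  rewrite big_ord0; have := h (fun k => r k + 1); rewrite big_ord0; apply.
  by move=> k; rewrite ltrDl.
rewrite big_ord_recl mulrA.
have step t : r 0%N < t -> D <= P * t * \prod_(k < n) r k.+1.
  move=> rt; apply: (IH _ (fun k => r k.+1)) => //.
    by rewrite mulr_ge0// (le_trans _ (ltW rt)).
  move=> s rs; have := h (fun k => if k is j.+1 then s j else t).
  by rewrite big_ord_recl/= mulrA; apply; case.
set Q := \prod_(i < n) _.
have Q0 : 0 <= P * Q by rewrite mulr_ge0//; exact: prodr_ge0.
rewrite mulrAC; apply/ler_addgt0Pr => e e0.
have PQ1 : 0 < P * Q + 1 by lra.
(* The increment costs [e * (P * Q / (P * Q + 1)) <= e]; the [+ 1] covers [P * Q = 0]. *)
apply: le_trans (step (r 0%N + e / (P * Q + 1)) _) _.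
  by rewrite ltrDl divr_gt0.
have : e * (P * Q / (P * Q + 1)) <= e.
  by rewrite ger_pMr// ler_pdivrMr// mul1r lerDl.
by rewrite -/Q; lra.
Qed.

End Determinants.

(** * Gelfand numbers of matrices on ell^2 *)

Section FiniteSections.
Variable R : realType.
Implicit Types u : nat -> R.

Lemma series_sqr_nondecreasing u :
  {homo series (fun k => u k ^+ 2) : m k / (m <= k)%N >-> m <= k}.
Proof. by apply: nondecreasing_series => i _ _; exact: sqr_ge0. Qed.

Lemma sum_sqr_le_l2norm u n : ell2 u -> \sum_(k < n) u k ^+ 2 <= l2norm u ^+ 2.
Proof.
move=> u2.
have := nondecreasing_cvgn_le (@series_sqr_nondecreasing u) u2 n.
rewrite /series/= big_mkord => le_lim.
rewrite /l2norm sqr_sqrtr//; apply: le_trans le_lim.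
by apply: sumr_ge0 => i _; exact: sqr_ge0.
Qed.

Lemma finite_support_ell2 u n : (forall k, (n <= k)%N -> u k = 0) ->
  ell2 u /\ l2norm u = Num.sqrt (\sum_(k < n) u k ^+ 2).
Proof.
move=> u0.
have cst : \forall m \near \oo,
    series (fun k => u k ^+ 2) m = \sum_(k < n) u k ^+ 2.
  exists n => // m /= nm; rewrite /series/= (big_cat_nat (n := n))//=.
  rewrite [X in _ + X]big_nat_cond [X in _ + X]big1 ?addr0 ?big_mkord//.
  by move=> i /andP[/andP[ni _] _]; rewrite u0// expr0n.
split; first exact: is_cvg_near_cst cst.
by rewrite /l2norm (lim_near_cst _ cst).
Qed.

Definition embed n (v : 'rV[R]_n) : nat -> R :=
  fun k => if insub k is Some i then v 0 i else 0.

Lemma embed_ord n (v : 'rV[R]_n) (i : 'I_n) : embed v i = v 0 i.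
Proof. by rewrite /embed valK. Qed.

Lemma embed_linear n a (v w : 'rV[R]_n) :
  embed (a *: v + w) = l2add (l2scale a (embed v)) (embed w).
Proof.
apply/funext => k; rewrite /l2add /l2scale /embed; case: insubP => [i _ _|_].
  by rewrite !mxE.
by rewrite mulr0 addr0.
Qed.

Lemma embedB n (v w : 'rV[R]_n) : embed v - embed w = embed (v - w).
Proof.
apply/funext => k; rewrite -[LHS]/(embed v k - embed w k) /embed.
by case: insubP => [i _ _|_]; rewrite ?mxE ?subr0.
Qed.

Lemma embedP n (v : 'rV[R]_n) :
  ell2 (embed v) /\ l2norm (embed v) = Num.sqrt (dotr v v).
Proof.
have [|v2 ->] := @finite_support_ell2 (embed v) n.
  by move=> k nk; rewrite /embed insubN// -leqNgt.
split=> //; congr Num.sqrt; rewrite dotrE; apply: eq_bigr => i _.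
by rewrite embed_ord expr2.
Qed.

Definition section_row n u : 'rV[R]_n := \row_(k < n) u k.

Lemma section_row_embed n (v : 'rV[R]_n) : section_row n (embed v) = v.
Proof. by apply/rowP => i; rewrite mxE embed_ord. Qed.

(** Vectors are rows, so [M^T] on the right is the usual action of [M] on the first [n] coordinates;
    all later output coordinates are zero. *)
Definition matrix_op n (M : 'M[R]_n) u : nat -> R :=
  embed (section_row n u *m M^T).

Lemma l2ball_coord_le1 n u (i : 'I_n) : l2ball u -> `|u i| <= 1.
Proof.
move=> [u2 u1].
rewrite -(@ler_pXn2r _ 2)// ?nnegrE// expr1n real_normK ?num_real//.
apply: le_trans (_ : \sum_(k < n) u k ^+ 2 <= _).
  by rewrite (bigD1 i)//= lerDl sumr_ge0// => k _; exact: sqr_ge0.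
apply: le_trans (sum_sqr_le_l2norm _ u2) _.
by rewrite expr_le1// sqrtr_ge0.
Qed.

(** The pair [(f, f)] meets every constraint and contributes [0] to each supremum. *)
Lemma gelfand_gen_ge0 (V : Type) (W : zmodType) dual (nW : W -> R) (T : V -> W)
    (F : set V) n : (forall w, 0 <= nW w) -> F !=set0 ->
  (0 <= gelfand_gen dual nW T F n)%E.
Proof.
move=> nW0 [f Ff]; apply: le_ereal_inf_tmp => _ [L [_ ->]].
apply: le_ereal_sup_tmp; exists (2^-1 * nW (T f - T f))%:E; first by exists f, f.
by rewrite lee_fin mulr_ge0.
Qed.

Lemma l2ball0 : l2ball (fun=> 0 : R).
Proof.
have [|c2 c0] := @finite_support_ell2 (fun=> 0) 0; first by [].
by split=> //; rewrite c0 big_ord0 sqrtr0.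
Qed.

(** Finiteness allows the product to be handled in the reals. Zero functionals compete in the
    infimum, and coordinates of two points of the ball differ by at most [2], whence [C]. *)
Lemma gelfand_l2_matrix_op_lty n (M : 'M[R]_n) k :
  (gelfand_l2 (matrix_op M) k < +oo)%E.
Proof.
pose C := Num.sqrt (\sum_(i < n) (\sum_(j < n) 2 * `|M i j|) ^+ 2).
apply: le_lt_trans (ltry (2^-1 * C)).
apply: ge_ereal_inf.
exists (ereal_sup [set s | exists f g, l2ball f /\ l2ball g /\
    (forall i : 'I_k, (fun=> 0 : R) f = (fun=> 0 : R) g) /\
    s = (2^-1 * l2norm (matrix_op M f - matrix_op M g))%:E]).
  exists (fun _ _ => 0); split=> // _; split=> [a u v _ _|].
    by rewrite mulr0 addr0.
  by exists 0 => u _; rewrite normr0 mul0r.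
apply: ge_ereal_sup => _ [f [g [Bf [Bg [_ ->]]]]].
rewrite lee_fin ler_pM2l// /matrix_op embedB -mulmxBl (embedP _).2.
apply: ler_wsqrtr; rewrite dotrE; apply: ler_sum => i _.
rewrite -expr2 -real_normK ?num_real//.
rewrite ler_pXn2r ?nnegrE//; last by apply: sumr_ge0 => j _; rewrite mulr_ge0.
rewrite mxE; apply: le_trans (ler_norm_sum _ _ _) _.
apply: ler_sum => j _; rewrite normrM !mxE ler_wpM2r//.
apply: le_trans (ler_normB _ _) _.
by have := l2ball_coord_le1 j Bf; have := l2ball_coord_le1 j Bg; lra.
Qed.

(** A functional restricted to the first [n] coordinates is a finite vector, so constraints on
    [ell2] become columns of a matrix. *)
Lemma in_l2dual_embed n (L : (nat -> R) -> R) : in_l2dual L ->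
  forall v : 'rV[R]_n, L (embed v) = \sum_i v 0 i * L (embed (delta_mx 0 i)).
Proof.
move=> [Llin _].
have Lemb a v w : L (embed (a *: v + w : 'rV_n)) = a * L (embed v) + L (embed w).
  by rewrite embed_linear Llin//; exact: (embedP _).1.
have L0 : L (embed (0 : 'rV_n)) = 0.
  by have := Lemb 1 0 0; rewrite scaler0 addr0; lra.
move=> v; rewrite [in LHS](row_sum_delta v).
elim/big_rec2 : _ => [//|i y1 y2 _ IH]; by rewrite Lemb IH.
Qed.

(** For any [s k] above the [k]-th Gelfand number, [k] functionals witness the bound [s k]; they
    form the columns of [N k], and the constrained determinant bound applies. *)
Lemma det_le_prod_gelfand_l2 n (M : 'M[R]_n) :
  ((`|\det M|)%:E <= \big[*%E/1%E]_(k < n) gelfand_l2 (matrix_op M) k)%E.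
Proof.
pose g k := gelfand_l2 (matrix_op M) k.
have g0 k : (0 <= g k)%E.
  apply: gelfand_gen_ge0; first by move=> w; exact: sqrtr_ge0.
  by exists (fun=> 0); exact: l2ball0.
have gfin k : g k = (fine (g k))%:E.
  by rewrite fineK// ge0_fin_numE// gelfand_l2_matrix_op_lty.
rewrite (eq_bigr (fun k : 'I_n => (fine (g k))%:E)) => [|k _]; last exact: gfin.
rewrite prodEFin lee_fin -[leRHS]mul1r.
apply: (@le_prod_of_gt _ n _ 1 (fun k => fine (g k))) => //.
  by move=> k; rewrite fine_ge0.
move=> s gs; rewrite mul1r.
have Lex k : exists L : 'I_k -> (nat -> R) -> R,
    (forall i, in_l2dual (L i)) /\
    forall f f', l2ball f -> l2ball f' -> (forall i, L i f = L i f') ->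
      2^-1 * l2norm (matrix_op M f - matrix_op M f') <= s k.
  have : (g k < (s k)%:E)%E by rewrite gfin lte_fin.
  move=> /ereal_inf_lt[_ [L [dL ->]] Ls]; exists L; split=> // f f' Bf Bf' Lff'.
  rewrite -lee_fin; apply: le_trans (ltW Ls); apply: ereal_sup_ubound.
  by exists f, f'.
pose L k := sval (cid (Lex k)).
pose N k : 'M[R]_(n, k) := \matrix_(a, i) L k i (embed (delta_mx 0 a)).
apply: (@det_le_prod_constrained_norms _ _ _ N) => k v kn vN v1.
have [dL Ls] := svalP (cid (Lex k)); rewrite -/(L k) in dL Ls.
have Lv i : L k i (embed v) = 0.
  rewrite (in_l2dual_embed (dL i)); have /rowP/(_ i) := vN.
  by rewrite !mxE => vN0; rewrite -[RHS]vN0; apply: eq_bigr => a _; rewrite mxE.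
have ballv w : dotr w w = 1 -> l2ball (embed (w : 'rV[R]_n)).
  by move=> w1; split; rewrite ?(embedP _).2 ?w1 ?sqrtr1//; exact: (embedP _).1.
(* The antipodal pair [v], [- v] has half difference [v], and all functionals vanish on both. *)
have := Ls (embed v) (embed (- v)) (ballv _ v1) _ _.
rewrite /matrix_op !section_row_embed embedB -mulmxBl opprK.
rewrite (_ : v + v = 2 *: v); last by rewrite scaler_nat mulr2n.
rewrite -scalemxAl (embedP _).2 dotrZ sqrtrM// -expr2 sqrtr_sqr ger0_norm//.
rewrite mulrA mulVf// mul1r; apply.
  by apply: ballv; rewrite -scaleN1r dotrZ mulrNN !mul1r.
move=> i; rewrite Lv.
by rewrite (in_l2dual_embed (dL i)) (eq_bigr (fun a => - (v 0 a * L k i (embed (delta_mx 0 a)))))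
  ?sumrN -?(in_l2dual_embed (dL i)) ?Lv ?oppr0// => a _; rewrite mxE mulNr.
Qed.

End FiniteSections.

(** * Products of extended reals *)

Section ExtendedRealProducts.
Variable R : realType.
Implicit Types c d : nat -> \bar R.

Lemma lee_prode n c d : (forall k, (k < n)%N -> (0 <= c k <= d k)%E) ->
  (\big[*%E/1%E]_(k < n) c k <= \big[*%E/1%E]_(k < n) d k)%E.
Proof.
elim: n c d => [|n IH] c d cd; first by rewrite !big_ord0.
rewrite !big_ord_recr/=.
have /andP[c0 c1] := cd n (ltnSn n).
apply: lee_pmul => //.
  by apply: prode_ge0 => k _; have /andP[] := cd k (ltnW (ltn_ord k)).
by apply: IH => k kn; apply: cd; rewrite ltnW.
Qed.

Lemma prode_gt0 n c : (forall k, (k < n)%N -> (0 < c k)%E) ->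
  (0 < \big[*%E/1%E]_(k < n) c k)%E.
Proof.
by move=> c0; elim/big_rec : _ => [|k x _ x0]; rewrite ?lte01// mule_gt0// c0.
Qed.

Lemma prode_eq0 n c k : (k < n)%N -> c k = 0%E ->
  (\big[*%E/1%E]_(k < n) c k = 0)%E.
Proof.
elim: n => [//|n IH]; rewrite ltnS leq_eqVlt big_ord_recr/= => /predU1P[->|kn] c0.
  by rewrite c0 mule0.
by rewrite IH// mul0e.
Qed.

Lemma real_between (x : R) (c : \bar R) : (0 < c)%E -> (x%:E < c)%E ->
  exists t, [/\ 0 < t, (t%:E < c)%E & x < t].
Proof.
case: c => [r| |//]; rewrite ?lte_fin => r0 xr; last first.
  by exists (`|x| + 1); rewrite ltry ltr_wpDl// ltr_pwDr// ler_norm.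
by exists ((r + Num.max 0 x) / 2); rewrite lte_fin; case: (leP 0 x) => ?; split; lra.
Qed.

(** Counterpart from below of [le_prod_of_gt]: the greedy choice reaches only reals strictly below
    each factor, and factors may be [+oo]. *)
Lemma prode_le_of_lt n c (P : R) (Z : \bar R) : 0 < P ->
  (forall k, (k < n)%N -> (0 < c k)%E) ->
  (forall t : nat -> R, (forall k, (k < n)%N -> 0 < t k /\ ((t k)%:E < c k)%E) ->
     ((P * \prod_(k < n) t k)%:E <= Z)%E) ->
  (P%:E * \big[*%E/1%E]_(k < n) c k <= Z)%E.
Proof.
elim: n P c => [|n IH] P c P0 c0 h.
  have := h (fun=> 0); rewrite !big_ord0 mulr1 mule1; exact.
rewrite big_ord_recl/=; set Q := \big[_/_]_(i < n) _.
have Q0 : (0 < Q)%E by apply: (prode_gt0 (c := fun k => c k.+1)) => k kn; exact: c0.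
have step t : 0 < t -> (t%:E < c 0%N)%E -> ((P * t)%:E * Q <= Z)%E.
  move=> t0 tc; apply: (IH _ (fun k => c k.+1)); first exact: mulr_gt0.
    by move=> k kn; exact: c0.
  move=> s sc; have := h (fun k => if k is j.+1 then s j else t).
  rewrite big_ord_recl/= mulrA; apply.
  by move=> [|k] kn //; exact: sc.
have c00 : (0 < c 0%N)%E by exact: c0.
have [t [t0 tc _]] := real_between c00 c00.
(* If the remaining product is [+oo], one admissible [t] already forces [Z = +oo]. *)
move: Q0 step; case: Q => [q| |//]; last first.
  move=> _ /(_ _ t0 tc); rewrite gt0_muley ?lte_fin ?mulr_gt0// leye_eq => /eqP ->.
  by rewrite leey.
rewrite lte_fin => q0.
case: Z {h IH} => [z| |] step; last 2 first.
- by rewrite leey.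
- by have := step _ t0 tc; rewrite -EFinM leeNy_eq.
have Pq0 : 0 < P * q by exact: mulr_gt0.
have : (c 0%N <= (z / (P * q))%:E)%E.
  rewrite leNgt; apply/negP => /(real_between c00)[s [s0 sc]].
  rewrite ltr_pdivrMr// ltNge => /negP; apply.
  by have := step _ s0 sc; rewrite -EFinM lee_fin; lra.
move: c00; case: (c 0%N) => [r| |//] _; last by rewrite leye_eq.
rewrite -!EFinM !lee_fin ler_pdivlMr//; lra.
Qed.

Lemma le_poweR (r : R) (x y : \bar R) : 0 <= r -> (0 <= x)%E -> (x <= y)%E ->
  (poweR x r <= poweR y r)%E.
Proof.
move=> r0 x0 xy; apply: gt0_ler_poweR => //; rewrite in_itv/= leey andbT//.
exact: le_trans xy.
Qed.

(** If some [c k] is zero, the left side vanishes. Otherwise [g ^- n] is pulled out of the product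
    and the [n]-th root turns [g ^+ n] into [g]. *)
Lemma geo_mean_le_of_lt n c d (g : R) : (0 < n)%N -> 0 < g ->
  (forall k, (0 <= c k)%E) -> (forall k, (0 <= d k)%E) ->
  (forall t : nat -> R, (forall k, (k < n)%N -> 0 < t k /\ ((t k)%:E < c k)%E) ->
     ((\prod_(k < n) (g^-1 * t k))%:E <= \big[*%E/1%E]_(k < n) d k)%E) ->
  (geo_mean n c <= g%:E * geo_mean n d)%E.
Proof.
move=> n0 g0 c0 d0 h.
have nV : n%:R^-1 != 0 :> R by rewrite invr_eq0 pnatr_eq0 -lt0n.
have [[k kn ck]|cpos] := pselect (exists2 k, (k < n)%N & c k = 0%E).
  rewrite /geo_mean (prode_eq0 kn ck) poweR0r//.
  by rewrite mule_ge0 ?lee_fin ?(ltW g0)//; exact: poweR_ge0.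
have cgt0 k : (k < n)%N -> (0 < c k)%E.
  by move=> kn; rewrite lt_def c0 andbT; apply/eqP => ck; apply: cpos; exists k.
set D := (\big[*%E/1%E]_(k < n) d k)%E in h *.
have D0 : (0 <= D)%E by exact: prode_ge0.
have gn0 : 0 < g ^+ n by exact: exprn_gt0.
have : ((g ^- n)%:E * \big[*%E/1%E]_(k < n) c k <= D)%E.
  apply: prode_le_of_lt => //; first by rewrite invr_gt0.
  by move=> t tc; have := h t tc; rewrite big_split/= prodr_const card_ord exprVn.
rewrite lee_pdivrMl// => /(le_poweR (r := n%:R^-1)) le_cd.
apply: (le_trans (le_cd _ _)); rewrite ?invr_ge0//; first exact: prode_ge0.
rewrite poweRM// ?lee_fin ?(ltW gn0)// poweR_EFin -powR_mulrn ?(ltW g0)//.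
by rewrite -powRrM mulfV ?powRr1 ?(ltW g0)// pnatr_eq0 -lt0n.
Qed.

Lemma geo_mean_ge_last n c : (0 < n)%N -> (forall k, (0 <= c k)%E) ->
  (forall j k, (j <= k)%N -> (c k <= c j)%E) -> (c n.-1 <= geo_mean n c)%E.
Proof.
move=> n0 c0 cmon; set x := c n.-1.
have nV : 0 < n%:R^-1 :> R by rewrite invr_gt0 ltr0n.
have x0 : (0 <= x)%E by exact: c0.
have xprod : (\big[*%E/1%E]_(k < n) x <= \big[*%E/1%E]_(k < n) c k)%E.
  apply: (lee_prode (c := fun=> x)) => k kn; rewrite x0 cmon//; lia.
apply: (@le_trans _ _ (poweR (\big[*%E/1%E]_(k < n) x)%E n%:R^-1)); last first.
  by apply: le_poweR; rewrite ?(ltW nV)//; apply: prode_ge0.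
move: x0; case: (x) => [r| |//] r0.
  rewrite prodEFin poweR_EFin lee_fin prodr_const card_ord -powR_mulrn//.
  by rewrite -powRrM mulfV ?powRr1// pnatr_eq0 -lt0n.
(* Here [x] is [+oo]; since [n > 0], the constant product is [+oo] and not the empty product [1]. *)
rewrite [X in poweR X](_ : _ = +oo%E) ?poweRyr ?gt_eqF//.
case: n n0 {x c c0 cmon xprod nV r0} => // n _.
elim: n => [|n IH]; rewrite big_ord_recl/= ?big_ord0 ?mule1//.
by rewrite IH mulyy.
Qed.

End ExtendedRealProducts.

(** * Lower bounds for Hilbert numbers *)

Section LinearMaps.
Variable R : realType.

Lemma lin_operator_sum (X Y : lmodType R) (T : X -> Y) n (a : nat -> R)
    (x : nat -> X) : lin_operator T ->
  T (\sum_(k < n) a k *: x k) = \sum_(k < n) a k *: T (x k).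
Proof.
move=> Tlin; elim: n => [|n IH].
  rewrite !big_ord0; have := Tlin 1 0 0; rewrite !scale1r addr0 => /eqP.
  by rewrite -subr_eq subrr eq_sym => /eqP.
by rewrite !big_ord_recr/= addrC Tlin IH addrC.
Qed.

Lemma lin_operatorB (X Y : lmodType R) (T : X -> Y) x y : lin_operator T ->
  T (x - y) = T x - T y.
Proof. by move=> Tlin; rewrite addrC -scaleN1r Tlin scaleN1r addrC. Qed.

Lemma lin_operatorZ (X Y : lmodType R) (T : X -> Y) a x : lin_operator T ->
  T (a *: x) = a *: T x.
Proof.
move=> Tlin; have T0 : T 0 = 0 by rewrite -(subrr 0) lin_operatorB// subrr.
by rewrite -[a *: x]addr0 Tlin T0 addr0.
Qed.

Lemma lin_functional_operator (X : lmodType R) (L : X -> R) :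
  lin_functional L -> lin_operator (L : X -> R^o).
Proof. by []. Qed.

Lemma in_dual_comp (X Y : normedModType R) (S : X -> Y) (L : Y -> R) :
  bounded_linear S -> in_dual L -> in_dual (L \o S).
Proof.
move=> [Slin Scont] [Llin Lcont]; split; first by move=> a x y /=; rewrite Slin Llin.
by move=> x; apply: continuous_comp; [exact: Scont|exact: Lcont].
Qed.

End LinearMaps.

Section HilbertLowerBound.
Variable R : realType.

(* The factorization [B S A] is the matrix [phi j (S (h k))], which is
   triangular, so its determinant is the product of its diagonal. *)
Lemma prod_le_prod_hilbert_num (X Y : normedModType R) (S : X -> Y) (F : set X)
    n (h : nat -> X) (phi : nat -> Y -> R) (x0 : X) :
  lin_operator S ->
  (forall j, lin_functional (phi j)) ->
  (forall y, \sum_(j < n) phi j y ^+ 2 <= `|y| ^+ 2) ->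
  (forall u : nat -> R, \sum_(k < n) u k ^+ 2 <= 1 ->
     F (\sum_(k < n) u k *: h k + x0)) ->
  (forall j k, (j < k < n)%N -> phi j (S (h k)) = 0) ->
  ((\prod_(k < n) phi k (S (h k)))%:E
     <= \big[*%E/1%E]_(k < n) hilbert_num S F k)%E.
Proof.
move=> Slin philin bessel Fh tri.
pose B y := embed (\row_(j < n) phi j y).
pose A (u : nat -> R) := \sum_(k < n) u k *: h k.
pose M : 'M[R]_n := \matrix_(j, k) phi j (S (h k)).
have BSA : B \o S \o A = matrix_op M.
  apply/funext => u; rewrite /B/= /matrix_op; congr embed.
  apply/rowP => j; rewrite !mxE [A u]/A lin_operator_sum//.
  rewrite [LHS](lin_operator_sum n u (S \o h) (lin_functional_operator (philin j))).
  by apply: eq_bigr => k _; rewrite !mxE.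
have Mtrig : is_trig_mx M.
  by apply/is_trig_mxP => j k jk; rewrite mxE tri// jk/=.
apply: le_trans (_ : _ <= (`|\det M|)%:E)%E _.
  rewrite det_trig// lee_fin; apply: le_trans (ler_norm _).
  by rewrite le_eqVlt; apply/orP; left; apply/eqP; apply: eq_bigr => k _; rewrite mxE.
apply: le_trans (det_le_prod_gelfand_l2 M) _.
apply: lee_prode => k _; apply/andP; split.
  apply: gelfand_gen_ge0; first by move=> w; exact: sqrtr_ge0.
  by exists (fun=> 0); exact: l2ball0.
apply: ereal_sup_ubound; exists B, A, x0; rewrite BSA.
split; first by move=> y; exact: (embedP _).1.
split.
  move=> a y y'; rewrite /B -embed_linear; congr embed.
  by apply/rowP => j; rewrite !mxE philin.
split.
  move=> y; rewrite /B (embedP _).2 -[leRHS]ger0_norm// -sqrtr_sqr ler_wsqrtr//.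
  apply: le_trans (bessel y); rewrite dotrE ler_sum// => j _.
  by rewrite !mxE expr2.
split.
  move=> a u v _ _; rewrite /A scaler_sumr -big_split/=; apply: eq_bigr => j _.
  by rewrite /l2add /l2scale scalerDl scalerA.
split.
  exists (\sum_(k < n) `|h k|) => u u2; rewrite /A mulr_suml.
  apply: le_trans (ler_norm_sum _ _ _) _; apply: ler_sum => j _.
  rewrite normrZ mulrC ler_wpM2l// -[leRHS]ger0_norm ?sqrtr_ge0//.
  rewrite -[leRHS]sqrtr_sqr -[leLHS]sqrtr_sqr ler_wsqrtr//.
  apply: le_trans (sum_sqr_le_l2norm n u2).
  by rewrite (bigD1 j)//= lerDl sumr_ge0// => i _; exact: sqr_ge0.
split=> // u [u2 u1]; apply: Fh.
apply: le_trans (sum_sqr_le_l2norm n u2) _.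
by rewrite expr_le1// sqrtr_ge0.
Qed.

(** Zero operators with base point [x0] are admissible in the supremum. *)
Lemma hilbert_num_ge0 (X Y : normedModType R) (S : X -> Y) (F : set X) k :
  lin_operator S -> F !=set0 -> (0 <= hilbert_num S F k)%E.
Proof.
move=> Slin [x0 Fx0].
have S0 : S 0 = 0 by rewrite -(subrr 0) lin_operatorB// subrr.
pose c0 : nat -> R := fun=> 0.
have cl2 : ell2 c0 /\ l2norm c0 = 0.
  by have [|? ->] := @finite_support_ell2 R c0 0; rewrite ?big_ord0 ?sqrtr0.
apply: le_ereal_sup_tmp; exists (gelfand_l2 ((fun=> c0) \o S \o (fun=> 0)) k).
  exists (fun=> c0), (fun=> 0), x0.
  split; first by move=> y; exact: cl2.1.
  split.
    by move=> a y y'; apply/funext => i; rewrite /l2add /l2scale mulr0 addr0.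
  split; first by move=> y; rewrite cl2.2.
  split; first by move=> a u v _ _; rewrite scaler0 addr0.
  split; first by exists 0 => u _; rewrite normr0 mul0r.
  by split=> // u _; rewrite add0r.
apply: gelfand_gen_ge0; first by move=> w; exact: sqrtr_ge0.
by exists (fun=> 0); exact: l2ball0.
Qed.

End HilbertLowerBound.

(** * Gelfand numbers and the greedy selection *)

Section GelfandNumbers.
Variables (R : realType) (X Y : normedModType R) (S : X -> Y) (F : set X).

Lemma gelfand_ge0 n : F !=set0 -> (0 <= gelfand S F n)%E.
Proof. by move=> F0; apply: gelfand_gen_ge0. Qed.

(** A list of [m] functionals is padded with zero functionals, which impose no constraint. *)
Lemma gelfand_nonincreasing m n : (m <= n)%N ->
  (gelfand S F n <= gelfand S F m)%E.
Proof.
move=> mn; apply: le_ereal_inf_tmp => _ [L [dL ->]]; apply: ge_ereal_inf.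
pose L' (i : 'I_n) : X -> R := if insub (val i) is Some j then L j else fun=> 0.
exists (ereal_sup [set s | exists f g, F f /\ F g /\
    (forall i, L' i f = L' i g) /\ s = (2^-1 * `|S f - S g|)%:E]).
  exists L'; split=> // i; rewrite /L'; case: insubP => [j _ _|_]; first exact: dL.
  by apply: (@bounded_in_dual _ _ _ 0) => [a x y|x]; rewrite ?mulr0 ?addr0// normr0 mul0r.
apply: ereal_sup_le => _ [f [g [Ff [Fg [L'fg ->]]]]].
exists f, g; split=> //; split=> //; split=> // j.
by have := L'fg (widen_ord mn j); rewrite /L' /= valK.
Qed.

Lemma gelfand_gap n (L : 'I_n -> X -> R) (t : R) : (forall i, in_dual (L i)) ->
  (t%:E < gelfand S F n)%E ->
  exists f g, [/\ F f, F g, forall i, L i f = L i g & t < 2^-1 * `|S f - S g|].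
Proof.
move=> dL tlt.
have /ereal_sup_gt[_ [f [g [Ff [Fg [Lfg ->]]]]]] : (t%:E < ereal_sup
    [set s | exists f g, F f /\ F g /\
      (forall i, L i f = L i g) /\ s = (2^-1 * `|S f - S g|)%:E])%E.
  by apply: lt_le_trans tlt _; apply: ereal_inf_lbound; exists L.
by rewrite lte_fin => tfg; exists f, g.
Qed.

Definition half_diff (z : X * X) : X := 2^-1 *: (z.1 - z.2).

(* Each pair chosen contributes the [m.+1] functionals [D h _], so the [k]-th
   choice is subject to [m.+1 * k] constraints. *)
Lemma greedy_pairs m (D : X -> 'I_m.+1 -> X -> R) n (t : nat -> R) :
  lin_operator S -> (forall h i, in_dual (D h i)) ->
  (forall k, (k < n)%N -> ((t k)%:E < gelfand S F (m.+1 * k))%E) ->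
  exists z : nat -> X * X, forall k, (k < n)%N ->
    [/\ F (z k).1, F (z k).2, t k < `|S (half_diff (z k))| &
      forall j i, (j < k)%N -> D (half_diff (z j)) i (half_diff (z k)) = 0].
Proof.
move=> Slin dD tlt.
have [k s kn _|z zP] := @compatible_sequence (X * X)%type (0, 0)
    (fun k z => [/\ F z.1, F z.2 & t k < `|S (half_diff z)|])
    (fun z z' => forall i, D (half_diff z) i (half_diff z') = 0) n; last first.
  exists z => k kn; have [[F1 F2 tk] Dk] := zP k kn.
  by split=> // j i jk; exact: Dk.
(* The index [a = j * m.+1 + i] encodes the [i]-th functional of the [j]-th pair. *)
pose L (a : 'I_(m.+1 * k)) := D (half_diff (s (a %/ m.+1)%N)) (inord (a %% m.+1)).
have [||f [g [Ff Fg Lfg tfg]]] := @gelfand_gap _ L (t k).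
- by move=> a; exact: dD.
- exact: tlt.
exists (f, g); split=> [|j jk i].
  split=> //; rewrite /half_diff lin_operatorZ//= lin_operatorB// normrZ.
  by rewrite gtr0_norm.
have alt : (j * m.+1 + i < m.+1 * k)%N by have := ltn_ord i; nia.
have := Lfg (Ordinal alt); rewrite /L /= divnMDl// divn_small// addn0.
rewrite modnMDl modn_small// inord_val => Dfg.
have [Dlin _] := dD (half_diff (s j)) i.
rewrite /half_diff [LHS](lin_operatorZ _ _ (lin_functional_operator Dlin)).
by rewrite (lin_operatorB _ _ (lin_functional_operator Dlin)) Dfg subrr scaler0.
Qed.

End GelfandNumbers.

(** * Convexity and inner products *)

Section Convexity.
Variables (R : realType) (X : lmodType R) (F : set X).
Hypothesis convF : convex_set F.

Lemma convex_set2 (a b : R) x y : 0 <= a -> 0 <= b -> a + b = 1 ->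
  F x -> F y -> F (a *: x + b *: y).
Proof.
move=> a0 b0 ab Fx Fy.
have a1 : a <= 1 by lra.
have Fxy : F (a *: x + (1 - a) *: y).
  exact: set_mem (convF (Itv01 a0 a1) (mem_set Fx) (mem_set Fy)).
by rewrite (_ : b = 1 - a)//; lra.
Qed.

(** [y] is the weighted average of the points. Stating the result without dividing by the total
    weight admits total weight zero, where [y] is any point of [F]. *)
Lemma convex_set_sum n (v : nat -> R) (x : nat -> X) : F !=set0 ->
  (forall k, (k < n)%N -> 0 <= v k /\ F (x k)) ->
  exists2 y, F y & \sum_(k < n) v k *: x k = (\sum_(k < n) v k) *: y.
Proof.
move=> [z Fz]; elim: n => [|n IH] vx.
  by exists z => //; rewrite !big_ord0 scale0r.
have [k kn|y Fy sumE] := IH; first by apply: vx; rewrite ltnW.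
have [v0 Fx] := vx n (ltnSn n).
rewrite !big_ord_recr/= sumE; set s := \sum_(k < n) v k.
have s0 : 0 <= s by apply: sumr_ge0 => k _; exact: (vx k (ltnW (ltn_ord k))).1.
have [sv|sv] := eqVneq (s + v n) 0.
  have [-> ->] : s = 0 /\ v n = 0 by lra.
  by exists z => //; rewrite addr0 !scale0r addr0.
have sv0 : 0 < s + v n by rewrite lt_def sv addr_ge0.
exists ((s / (s + v n)) *: y + (v n / (s + v n)) *: x n).
  by apply: convex_set2; rewrite ?divr_ge0 ?addr_ge0// -mulrDl mulfV.
by rewrite scalerDr !scalerA !(mulrC (s + v n)) !mulfVK.
Qed.

(** Signs of the coefficients are absorbed into the points by symmetry, and the missing weight
    [1 - s] is placed on [0]. *)
Lemma symmetric_convex_sum n (v : nat -> R) (x : nat -> X) :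
  symmetric_set F -> F !=set0 -> (forall k, (k < n)%N -> F (x k)) ->
  \sum_(k < n) `|v k| <= 1 -> F (\sum_(k < n) v k *: x k).
Proof.
move=> symF F0 Fx v1.
have F00 : F 0.
  have [z Fz] := F0.
  have := @convex_set2 2^-1 2^-1 z (- z) _ _ _ Fz (symF _ Fz).
  by rewrite scalerN subrr; apply; lra.
have [|y Fy] := @convex_set_sum n (fun k => `|v k|)
    (fun k => if v k < 0 then - x k else x k) F0.
  by move=> k /Fx Fxk; split=> //; case: ifP => // _; exact: symF.
set s := \sum_(k < n) `|v k| in v1 *.
have s0 : 0 <= s by exact: sumr_ge0.
rewrite (eq_bigr (fun k : 'I_n => v k *: x k)) => [->|k _]; last first.
  case: ltP => v0; last by rewrite ger0_norm.
  by rewrite ltr0_norm// scalerN scaleNr opprK.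
have -> : s *: y = s *: y + (1 - s) *: 0 by rewrite scaler0 addr0.
by apply: convex_set2 => //; lra.
Qed.

Lemma half_diff_in (z : X * X) : symmetric_set F -> F z.1 -> F z.2 ->
  F (2^-1 *: (z.1 - z.2)).
Proof.
move=> symF F1 F2; rewrite scalerBr -scalerN.
by apply: convex_set2; [lra|lra|lra|exact: F1|exact: symF].
Qed.

(* [n^-1 sum_k ((f_k + g_k)/2 + u_k (f_k - g_k)/2)] is an average of points on
   the segments [f_k, g_k]. *)
Lemma convex_set_cube n (z : nat -> X * X) (u : nat -> R) :
  (0 < n)%N -> (forall k, (k < n)%N -> F (z k).1 /\ F (z k).2) ->
  (forall k, (k < n)%N -> `|u k| <= 1) ->
  F (\sum_(k < n) u k *: (n%:R^-1 *: (2^-1 *: ((z k).1 - (z k).2))) +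
     \sum_(k < n) n%:R^-1 *: (2^-1 *: ((z k).1 + (z k).2))).
Proof.
move=> n0 Fz u1; rewrite -big_split/=.
have [||y Fy] := @convex_set_sum n (fun=> n%:R^-1) (fun k =>
    ((1 + u k) / 2) *: (z k).1 + ((1 - u k) / 2) *: (z k).2).
- by have [F1 _] := Fz 0%N n0; exists (z 0%N).1.
- move=> k kn; have [F1 F2] := Fz k kn; have := u1 k kn.
  rewrite ler_norml => /andP[? ?]; split; first by rewrite invr_ge0.
  by apply: convex_set2 => //; lra.
rewrite sumr_const card_ord -[_^-1 *+ n]mulr_natr mulVf ?pnatr_eq0 -?lt0n// scale1r => yE.
rewrite (_ : \sum_(k < n) _ = y)// -yE; apply: eq_bigr => k _.
rewrite (scalerA (u k)) (mulrC (u k)) -(scalerA _ (u k)) -scalerDr; congr (_ *: _).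
rewrite scalerA !scalerDr scalerN addrACA -!scalerDl -scaleNr -scalerDl.
by congr (_ *: _ + _ *: _); lra.
Qed.

End Convexity.

(** Source of the scaling [1 / sqrt n] for symmetric [F]: it shrinks the Euclidean ball into the set
    of coefficients with absolute sum at most [1]. *)
Lemma sum_norm_le_sqrt (R : realType) n (u : nat -> R) :
  \sum_(k < n) u k ^+ 2 <= 1 -> \sum_(k < n) `|u k| <= Num.sqrt n%:R.
Proof.
move=> u1; have [->|n0] := posnP n; first by rewrite big_ord0 sqrtr_ge0.
have s0 : 0 < Num.sqrt n%:R :> R by rewrite sqrtr_gt0 ltr0n.
set s := Num.sqrt _ in s0 *.
have sn : s ^+ 2 = n%:R by rewrite sqr_sqrtr.
(* AM-GM: 2 |u| <= s u^2 + 1 / s *)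
have : \sum_(k < n) (2 * `|u k|) <= \sum_(k < n) (s * u k ^+ 2 + s^-1).
  apply: ler_sum => k _; rewrite -subr_ge0.
  have -> : s * u k ^+ 2 + s^-1 - 2 * `|u k| = s^-1 * (s * `|u k| - 1) ^+ 2.
    by rewrite -(real_normK (num_real (u k))); field; rewrite gt_eqF.
  by rewrite mulr_ge0 ?invr_ge0 ?(ltW s0)// sqr_ge0.
rewrite -mulr_sumr big_split/= -mulr_sumr sumr_const card_ord -[_^-1 *+ n]mulr_natr -sn.
have -> : s^-1 * s ^+ 2 = s by rewrite expr2 mulrA mulVf ?gt_eqF// mul1r.
have : s * \sum_(k < n) u k ^+ 2 <= s by rewrite ger_pMr.
lra.
Qed.

Section InnerProduct.
Variables (R : realType) (X : normedModType R) (ip : X -> X -> R).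
Hypothesis ipC : forall x y, ip x y = ip y x.
Hypothesis ipDZ : forall (a : R) x y z, ip (a *: x + y) z = a * ip x z + ip y z.
Hypothesis ipxx : forall x, ip x x = `|x| ^+ 2.

Lemma ip_lin x : lin_functional (ip x).
Proof. by move=> a y z; rewrite ipC ipDZ !(ipC x). Qed.

Lemma ip_sumr n (a : nat -> R) (x : nat -> X) y :
  ip y (\sum_(k < n) a k *: x k) = \sum_(k < n) a k * ip y (x k).
Proof. exact: (lin_operator_sum n a x (lin_functional_operator (ip_lin y))). Qed.

Definition orthogonal_family n (x : nat -> X) :=
  forall j k, (j < k < n)%N -> ip (x j) (x k) = 0.

Lemma norm_orthogonal_sum n (a : nat -> R) (x : nat -> X) :
  orthogonal_family n x ->
  `|\sum_(k < n) a k *: x k| ^+ 2 = \sum_(k < n) a k ^+ 2 * `|x k| ^+ 2.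
Proof.
move=> orth; rewrite -ipxx ip_sumr; apply: eq_bigr => k _.
rewrite ipC ip_sumr (bigD1 k)//= big1 ?addr0 => [|j jk]; last first.
  have [lt|lt|/val_inj eq] := ltngtP j k; last by rewrite eq eqxx in jk.
    by rewrite ipC orth ?mulr0// lt/=.
  by rewrite orth ?mulr0// lt/=.
by rewrite ipxx mulrA expr2.
Qed.

(** [p] is the orthogonal projection of [y] onto the span of the [w k], and
    [|y - p| ^+ 2 = |y| ^+ 2 - s]. *)
Lemma bessel_inequality n (w : nat -> X) y : orthogonal_family n w ->
  (forall k, (k < n)%N -> `|w k| != 0) ->
  \sum_(k < n) (ip (w k) y / `|w k|) ^+ 2 <= `|y| ^+ 2.
Proof.
move=> orth w0.
pose a k := ip (w k) y / `|w k| ^+ 2.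
pose p := \sum_(k < n) a k *: w k.
set s := \sum_(k < n) _.
have aE (k : 'I_n) : a k * ip y (w k) = (ip (w k) y / `|w k|) ^+ 2.
  by rewrite /a ipC; field; exact: w0.
have py : ip y p = s by rewrite ip_sumr; apply: eq_bigr => k _; exact: aE.
have pp : ip p p = s.
  rewrite ipxx norm_orthogonal_sum//; apply: eq_bigr => k _.
  by rewrite /a; field; exact: w0.
have ipB z : ip z (y - p) = ip z y - ip z p.
  by rewrite addrC -scaleN1r ip_lin; lra.
have := sqr_ge0 `|y - p|.
rewrite -(ipxx (y - p)) ipB !(ipC (y - p)) !ipB pp (ipC p y) py ipxx; lra.
Qed.

(** For nonzero [x] this is Bessel's inequality for a one-element family. *)
Lemma cauchy_schwarz x y : `|ip x y| <= `|x| * `|y|.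
Proof.
have [->|x0] := eqVneq x 0.
  rewrite normr0 mul0r ipC; have := ip_lin y 1 0 0.
  by rewrite scaler0 addr0 => ip0; rewrite (_ : ip y 0 = 0) ?normr0//; lra.
have nx0 : 0 < `|x| by rewrite normr_gt0.
have := @bessel_inequality 1 (fun=> x) y _ _; rewrite big_ord1 => xy.
have {xy}: (ip x y / `|x|) ^+ 2 <= `|y| ^+ 2.
  by apply: xy => [j k|k _]; [lia|rewrite gt_eqF].
rewrite -(real_normK (num_real (ip x y / _))) ler_pXn2r ?nnegrE//.
by rewrite normrM normfV normr_id ler_pdivrMr// mulrC.
Qed.

Lemma ip_in_dual x : in_dual (ip x).
Proof. exact: bounded_in_dual (ip_lin x) (cauchy_schwarz x). Qed.

(** For [x = 0] the inverse is [0] by convention and the functional is zero; the constant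
    [|x|^-1 * |x|] covers both cases. *)
Lemma ip_normalized_in_dual x : in_dual (fun y => `|x|^-1 * ip x y).
Proof.
apply: (@bounded_in_dual _ _ _ (`|x|^-1 * `|x|)) => [a y z|y].
  by rewrite ip_lin mulrDr mulrCA.
by rewrite normrM normfV normr_id -mulrA ler_wpM2l ?invr_ge0// cauchy_schwarz.
Qed.

End InnerProduct.

(** * The scaling argument shared by all cases *)

Section Comparison.
Variables (R : realType) (X Y : normedModType R) (S : X -> Y) (F : set X).
Hypothesis Sbl : bounded_linear S.
Hypothesis F0 : F !=set0.

(* [alpha] and [beta] are the scalings that make [y |-> (alpha N(w_j) y)_j] a
   contraction into ell^2 and keep the [beta]-scaled half differences, recentred,
   inside [F]. *)
Lemma geo_gelfand_le_geo_hilbert n m (N : Y -> Y -> R)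
    (D : X -> 'I_m.+1 -> X -> R) (alpha beta : R) :
  (0 < n)%N -> 0 < alpha -> 0 < beta ->
  (forall w, in_dual (N w)) -> (forall w, N w w = `|w|) ->
  (forall h i, in_dual (D h i)) -> (forall h x, D h ord0 x = N (S h) (S x)) ->
  (forall w : nat -> Y, (forall k, (k < n)%N -> 0 < `|w k|) ->
     (forall j k, (j < k < n)%N -> N (w j) (w k) = 0) ->
     forall y, \sum_(j < n) (alpha * N (w j) y) ^+ 2 <= `|y| ^+ 2) ->
  (forall z : nat -> X * X, (forall k, (k < n)%N -> F (z k).1 /\ F (z k).2) ->
     (forall j k i, (j < k < n)%N -> D (half_diff (z j)) i (half_diff (z k)) = 0) ->
     exists x0, forall u : nat -> R, \sum_(k < n) u k ^+ 2 <= 1 ->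
       F (\sum_(k < n) u k *: (beta *: half_diff (z k)) + x0)) ->
  (geo_mean n (fun k => gelfand S F (m.+1 * k))
     <= ((alpha * beta)^-1)%:E * geo_mean n (hilbert_num S F))%E.
Proof.
move=> n0 a0 b0 dN NE dD DN contr inF.
have Slin := Sbl.1.
apply: geo_mean_le_of_lt => //.
- by rewrite invr_gt0 mulr_gt0.
- by move=> k; exact: gelfand_ge0.
- by move=> k; exact: hilbert_num_ge0.
(* With [g = (alpha * beta)^-1] the factors are [alpha * beta * t k], and they lie below the
   diagonal entries [alpha * beta * |w k|]. *)
move=> t tc; rewrite invrK.
have [z zP] := greedy_pairs Slin dD (fun k kn => (tc k kn).2).
pose w k := S (half_diff (z k)).
have Dz j k i : (j < k < n)%N -> D (half_diff (z j)) i (half_diff (z k)) = 0.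
  by move=> /andP[jk kn]; have [_ _ _] := zP k kn; apply.
have Nw j k : (j < k < n)%N -> N (w j) (w k) = 0.
  by move=> jk; rewrite -DN Dz.
have tw k : (k < n)%N -> 0 < t k < `|w k|.
  by move=> kn; have [_ _ ->] := zP k kn; rewrite (tc k kn).1.
have [k kn|x0 Fx0] := inF z _ Dz; first by have [? ?] := zP k kn.
have wpos k : (k < n)%N -> 0 < `|w k|.
  by move=> /tw/andP[t0 tk]; exact: lt_trans t0 tk.
have NwE k : N (w k) (S (beta *: half_diff (z k))) = beta * `|w k|.
  rewrite lin_operatorZ// -NE.
  exact: (lin_operatorZ _ _ (lin_functional_operator (dN (w k)).1)).
have Nw0 j k : (j < k < n)%N -> N (w j) (S (beta *: half_diff (z k))) = 0.
  move=> jk; rewrite lin_operatorZ//.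
  rewrite [LHS](lin_operatorZ _ _ (lin_functional_operator (dN (w j)).1)).
  by rewrite [N _ _]Nw// scaler0.
apply: le_trans (@prod_le_prod_hilbert_num _ _ _ S F n
  (fun k => beta *: half_diff (z k)) (fun j y => alpha * N (w j) y) x0
  Slin _ (contr _ wpos Nw) Fx0 _).
- rewrite lee_fin; apply: ler_prod => k _.
  have /andP[t0 tk] := tw k (ltn_ord k).
  by rewrite NwE -mulrA !mulr_ge0 ?(ltW t0) ?(ltW a0) ?(ltW b0)//= !ler_pM2l// ltW.
- by move=> j a x y; rewrite (dN _).1 mulrDr mulrCA.
- by move=> j k /Nw0 ->; rewrite mulr0.
Qed.

End Comparison.

(** * Comparison of geometric means *)

Section NormingFamilies.
Variables (R : realType) (Y : normedModType R).

(** The contraction bound is asked only of families that are triangular for [N], because in a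
    Hilbert space it is Bessel's inequality. *)
Definition norming_contraction n (N : Y -> Y -> R) (alpha : R) :=
  [/\ forall w, in_dual (N w), forall w, N w w = `|w| &
    forall w : nat -> Y, (forall k, (k < n)%N -> 0 < `|w k|) ->
      (forall j k, (j < k < n)%N -> N (w j) (w k) = 0) ->
      forall y, \sum_(j < n) (alpha * N (w j) y) ^+ 2 <= `|y| ^+ 2].

(** Norming functionals from Hahn-Banach satisfy [|N w y| <= |y|], so each of the [n] squares is at
    most [|y| ^+ 2 / n]. *)
Lemma norming_contraction_normed n : (0 < n)%N ->
  exists N, norming_contraction n N (Num.sqrt n%:R)^-1.
Proof.
move=> n0; have [N NP] := choice (@norming_functional R Y).
exists N; split=> [w|w|w _ _ y]; try by have [] := NP w.
rewrite (le_trans (ler_sum _ (G := fun=> n%:R^-1 * `|y| ^+ 2) _))// => [j _|].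
  rewrite exprMn exprVn sqr_sqrtr// ler_wpM2l ?invr_ge0//.
  rewrite -real_normK ?num_real// ler_pXn2r ?nnegrE//.
  by have [_ _] := NP (w j).
rewrite sumr_const card_ord -[_ *+ n]mulr_natr mulrAC mulVf ?mul1r//.
by rewrite pnatr_eq0 -lt0n.
Qed.

(** The norming functional of [w] is the inner product with [w / |w|]; triangularity then means
    orthogonality. *)
Lemma norming_contraction_hilbert n : is_hilbert Y ->
  exists N, norming_contraction n N 1.
Proof.
move=> [ip [ipC [ipDZ ipxx]]].
exists (fun w y => `|w|^-1 * ip w y); split=> [w|w|w wpos Nw y].
- exact: ip_normalized_in_dual.
- have [w0|w0] := eqVneq `|w| 0; rewrite ipxx; first by rewrite w0 invr0 mul0r.
  by rewrite expr2 mulrA mulVf// mul1r.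
have w0 k : (k < n)%N -> `|w k| != 0 by move=> /wpos ?; rewrite gt_eqF.
apply: le_trans (bessel_inequality ipC ipDZ ipxx y _ w0).
  by apply: ler_sum => j _; rewrite mul1r mulrC.
move=> j k jk; have /eqP := Nw j k jk; rewrite mulf_eq0 invr_eq0.
have /andP[ltjk kn] := jk.
by rewrite (negPf (w0 j (ltn_trans ltjk kn))) => /eqP.
Qed.

End NormingFamilies.

(** * Scalings for convex sets, symmetric convex sets and Hilbert balls *)

Section Cases.
Variables (R : realType) (X Y : normedModType R) (S : X -> Y) (F : set X).
Variables (n : nat) (N : Y -> Y -> R) (alpha : R).
Hypothesis Sbl : bounded_linear S.
Hypothesis F0 : F !=set0.
Hypothesis n0 : (0 < n)%N.
Hypothesis a0 : 0 < alpha.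
Hypothesis normN : norming_contraction n N alpha.

Lemma natr_gt0 : 0 < n%:R :> R. Proof. by rewrite ltr0n. Qed.

(** With [m = 0] each pair contributes only its norming functional, so all Gelfand numbers occur. *)
Lemma geo_gelfand_le_of_scaling (beta : R) : 0 < beta ->
  (forall z : nat -> X * X, (forall k, (k < n)%N -> F (z k).1 /\ F (z k).2) ->
     exists x0, forall u : nat -> R, \sum_(k < n) u k ^+ 2 <= 1 ->
       F (\sum_(k < n) u k *: (beta *: half_diff (z k)) + x0)) ->
  (geo_mean n (gelfand S F)
     <= ((alpha * beta)^-1)%:E * geo_mean n (hilbert_num S F))%E.
Proof.
move=> b0 inF; have [dN NE contr] := normN.
rewrite (_ : gelfand S F = fun k => gelfand S F (1 * k)); last first.
  by apply/funext => k; rewrite mul1n.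
apply: (@geo_gelfand_le_geo_hilbert _ _ _ _ _ Sbl F0 _ 0 N
  (fun h _ => N (S h) \o S)) => //; first by move=> h _; exact: in_dual_comp.
by move=> z Fz _; exact: inF.
Qed.

(** Here [beta = 1 / n]: the Euclidean ball lies in the cube, and the centre is the mean of the
    midpoints of the pairs. *)
Lemma geo_gelfand_le_convex : convex_set F ->
  (geo_mean n (gelfand S F)
     <= ((alpha * n%:R^-1)^-1)%:E * geo_mean n (hilbert_num S F))%E.
Proof.
move=> convF; apply: geo_gelfand_le_of_scaling; first by rewrite invr_gt0 natr_gt0.
move=> z Fz; exists (\sum_(k < n) n%:R^-1 *: (2^-1 *: ((z k).1 + (z k).2))).
move=> u u1; apply: (convex_set_cube convF n0 Fz) => k kn.
rewrite -(@ler_pXn2r _ 2)// ?nnegrE// expr1n real_normK ?num_real//.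
apply: le_trans u1; rewrite (bigD1 (Ordinal kn))//= lerDl sumr_ge0// => i _.
exact: sqr_ge0.
Qed.

Lemma geo_gelfand_le_symmetric : convex_set F -> symmetric_set F ->
  (geo_mean n (gelfand S F)
     <= ((alpha * (Num.sqrt n%:R)^-1)^-1)%:E * geo_mean n (hilbert_num S F))%E.
Proof.
move=> convF symF.
have s0 : 0 < Num.sqrt n%:R :> R by rewrite sqrtr_gt0 natr_gt0.
apply: geo_gelfand_le_of_scaling; first by rewrite invr_gt0.
move=> z Fz; exists 0 => u u1; rewrite addr0.
under eq_bigr do rewrite scalerA.
apply: (symmetric_convex_sum convF (v := fun k => u k * (Num.sqrt n%:R)^-1)
  (x := fun k => half_diff (z k))) => //.
  by move=> k /Fz[F1 F2]; exact: half_diff_in.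
under eq_bigr do rewrite normrM (gtr0_norm (x := _^-1)) ?invr_gt0//.
by rewrite -mulr_suml ler_pdivrMr// mul1r sum_norm_le_sqrt.
Qed.

(** With [m = 1] each pair also contributes the inner product with its half difference. This doubles
    the indices but makes the half differences orthogonal; having norm at most [1], they map the
    Euclidean ball into [F] with [beta = 1]. *)
Lemma geo_gelfand_le_hilbert_ball : is_hilbert X -> F = @unit_ball R X ->
  (geo_mean n (fun k => gelfand S F (2 * k))
     <= (alpha^-1)%:E * geo_mean n (hilbert_num S F))%E.
Proof.
move=> [ip [ipC [ipDZ ipxx]]] FE; have [dN NE contr] := normN.
rewrite -[alpha]mulr1.
pose D h (i : 'I_2) := if i == ord0 then N (S h) \o S else ip h.
apply: (@geo_gelfand_le_geo_hilbert _ _ _ _ _ Sbl F0 _ 1 N D) => //.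
  move=> h i; rewrite /D; case: ifP => _; first exact: in_dual_comp.
  exact: ip_in_dual.
move=> z Fz Dz; exists 0 => u u1; rewrite addr0 FE /unit_ball/=.
under eq_bigr do rewrite scale1r.
rewrite -(@ler_pXn2r _ 2)// ?nnegrE// expr1n.
rewrite (norm_orthogonal_sum ipC ipDZ ipxx u (x := fun k => half_diff (z k))).
  apply: le_trans u1; apply: ler_sum => k _.
  rewrite ler_piMr ?sqr_ge0// expr_le1// /half_diff normrZ gtr0_norm//.
  have [] := Fz k (ltn_ord k); rewrite FE /unit_ball/= => z1 z2.
  by have := ler_normB (z k).1 (z k).2; lra.
(* [ord_max] selects the inner product constraint. *)
by move=> j k jk; have := Dz j k ord_max jk.
Qed.

End Cases.

Unset Implicit Arguments.

Theorem theorem3p2 (R : realType) (X Y : completeNormedModType R)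
    (S : X -> Y) (F : set X) (n : nat) :
  bounded_linear S -> convex_set F -> F !=set0 -> (0 < n)%N ->
  (gelfand S F n.-1 <= geo_mean n (gelfand S F))%E /\
  [/\       (geo_mean n (gelfand S F)
         <= (n%:R `^ (3 / 2))%:E * geo_mean n (hilbert_num S F))%E,
      symmetric_set F ->
        (geo_mean n (gelfand S F)
           <= (n%:R `^ 1)%:E * geo_mean n (hilbert_num S F))%E,
      is_hilbert Y ->
        (geo_mean n (gelfand S F)
           <= (n%:R `^ 1)%:E * geo_mean n (hilbert_num S F))%E,
      symmetric_set F -> is_hilbert Y ->
        (geo_mean n (gelfand S F)
           <= (n%:R `^ (1 / 2))%:E * geo_mean n (hilbert_num S F))%E &
      is_hilbert X -> F = @unit_ball R X ->
        (gelfand S F (2 * n - 2)%N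
           <= geo_mean n (fun k => gelfand S F (2 * k)%N))%E /\
        (geo_mean n (fun k => gelfand S F (2 * k)%N)
           <= (n%:R `^ (1 / 2))%:E * geo_mean n (hilbert_num S F))%E].
Proof.
move=> Sbl convF F0 n0.
have nR : 0 < n%:R :> R by rewrite ltr0n.
have s0 : 0 < Num.sqrt n%:R :> R by rewrite sqrtr_gt0.
have sV0 : 0 < (Num.sqrt n%:R)^-1 :> R by rewrite invr_gt0.
have p1 : n%:R `^ 1 = n%:R :> R by rewrite powRr1// ltW.
have p12 : n%:R `^ (1 / 2) = Num.sqrt n%:R :> R.
  by rewrite div1r powR12_sqrt// ltW.
(* The factor [sqrt n] is the cost of the functionals on a general [Y], the factor [n] that of a
   merely convex [F]. *)
have p32 : n%:R `^ (3 / 2) = Num.sqrt n%:R * n%:R :> R.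
  rewrite (_ : 3 / 2 = 1 / 2 + 1 :> R); last by lra.
  by rewrite powRD ?p12 ?p1// gt_eqF// implybT.
have ss : Num.sqrt n%:R * Num.sqrt n%:R = n%:R :> R.
  by rewrite -expr2 sqr_sqrtr// ltW.
have [N normN] := @norming_contraction_normed R Y n n0.
have first := @geo_mean_ge_last R n.
split.
  apply: first => // [k|j k jk]; first exact: gelfand_ge0.
  exact: gelfand_nonincreasing.
split.
- have := geo_gelfand_le_convex Sbl F0 n0 sV0 normN convF.
  by rewrite invfM !invrK p32.
- move=> symF; have := geo_gelfand_le_symmetric Sbl F0 n0 sV0 normN convF symF.
  by rewrite invfM !invrK ss p1.
- move=> /(norming_contraction_hilbert n)[N' normN'].
  have := geo_gelfand_le_convex Sbl F0 n0 ltr01 normN' convF.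
  by rewrite p1 mul1r invrK.
- move=> symF /(norming_contraction_hilbert n)[N' normN'].
  have := geo_gelfand_le_symmetric Sbl F0 n0 ltr01 normN' convF symF.
  by rewrite p12 mul1r invrK.
- move=> HX FE; split.
    (* The index is twice the last one, so [first] applies to the even-indexed subsequence. *)
    rewrite (_ : 2 * n - 2 = 2 * n.-1)%N; last by lia.
    apply: (first (fun k => gelfand S F (2 * k)%N)) => // [k|j k jk].
      exact: gelfand_ge0.
    by apply: gelfand_nonincreasing; rewrite leq_mul2l.
  (* [Y] is arbitrary here, so [alpha] is [1 / sqrt n] and accounts for the whole factor. *)
  have := geo_gelfand_le_hilbert_ball Sbl F0 n0 sV0 normN HX FE.
  by rewrite invrK p12.
Qed.
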